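(* Let $d<0$ be square-free, $\mathbb{K}=\mathbb{Q}(\sqrt{d})$ with ring of integers $\mathcal{O}_{\mathbb{K}}$ and discriminant $\Delta_{\mathbb{K}}$. Fix integers $0<n<N$, a constant $V>0$, and a Riemann integrable function $f:\mathbb{R}^{2N}\to\mathbb{R}$ of bounded support. For each rational prime $p$ that splits in $\mathcal{O}_{\mathbb{K}}$, choose a prime ideal $\mathfrak{p}$ above $p$ (so $\mathcal{O}_{\mathbb{K}}/\mathfrak{p}\cong\mathbb{F}_p$) and a ring isomorphism $\mathcal{M}:\mathbb{F}_p\to\mathcal{O}_{\mathbb{K}}/\mathfrak{p}$; let $\mathcal{C}$ be the set of all $n$-dimensional linear codes $C\subseteq\mathbb{F}_p^N$, let $\Lambda_C=\{\mathbf{v}\in\mathcal{O}_{\mathbb{K}}^N:(v_i+\mathfrak{p})_i\in\mathcal{M}(C)\}$, and let $\gamma=\gamma_p>0$ be defined by $\gamma^{2N}\left(\frac{\sqrt{|\Delta_{\mathbb{K}}|}}{2}\right)^N p^{N-n}=V$ (so that $V=\mathrm{Vol}(\mathcal{V}_{\gamma\Lambda_C})$). Then, as $p\to\infty$ through splitting primes (so that $\gamma^2\frac{\sqrt{|\Delta_{\mathbb{K}}|}}{2}\to0$), $$\frac{1}{|\mathcal{C}|}\sum_{C\in\mathcal{C}}\ \sum_{\mathbf{v}\in\gamma\Lambda_C\setminus\{\mathbf{0}\}} f(\mathbf{v})\ \longrightarrow\ V^{-1}\int_{\mathbb{R}^{2N}} f(\mathbf{v})\,d\mathbf{v},$$ where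 $\mathbb{C}^N$ is identified with $\mathbb{R}^{2N}$ via real and imaginary parts.
   Context: For square-free $d<0$, $\mathcal{O}_{\mathbb{K}}=\mathbb{Z}[\xi]$ with $\xi=\sqrt{d}$ and $\Delta_{\mathbb{K}}=4d$ if $d\equiv 2,3 \pmod 4$, and $\xi=(1+\sqrt{d})/2$ and $\Delta_{\mathbb{K}}=d$ if $d\equiv 1\pmod 4$. A rational prime $p$ splits in $\mathcal{O}_{\mathbb{K}}$ if $p\mathcal{O}_{\mathbb{K}}=\mathfrak{p}\bar{\mathfrak{p}}$ with $\mathfrak{p}\ne\bar{\mathfrak{p}}$ prime ideals, each of norm $p$. $\mathcal{V}_{\Lambda}$ denotes the Voronoi (fundamental) region of a lattice $\Lambda$. *)

(* Defs.v *)
From HB Require Import structures.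
From mathcomp Require Import all_boot all_order all_algebra.
From mathcomp Require Import all_classical all_reals all_analysis.
Set Implicit Arguments. Unset Strict Implicit. Unset Printing Implicit Defensive.
Import Order.TTheory GRing.Theory Num.Theory.
Import numFieldNormedType.Exports.
Local Open Scope ring_scope.

Definition squarefree (d : int) : Prop :=
  forall k : nat, (k%:Z ^+ 2 %| d)%Z -> k = 1%N.

Definition d1mod4 (d : int) : bool := ((d %% 4)%Z == 1).

Definition disc (d : int) : int := if d1mod4 d then d else 4 * d.

(* O_K = Z[xi]; the pair (a, b) stands for a + b*xi, where
   xi = sqrt d            (d = 2,3 mod 4), xi^2 = d,
   xi = (1 + sqrt d) / 2  (d = 1 mod 4),   xi^2 = (d-1)/4 + xi. *)
Definition OK := (int * int)%type.
Definition xi2t (d : int) : int := if d1mod4 d then ((d - 1) %/ 4)%Z else d.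
Definition xi2s (d : int) : int := if d1mod4 d then 1 else 0.

Definition OK0 : OK := (0, 0).
Definition OK1 : OK := (1, 0).
Definition OKadd (x y : OK) : OK := (x.1 + y.1, x.2 + y.2).
Definition OKopp (x : OK) : OK := (- x.1, - x.2).
Definition OKmul (d : int) (x y : OK) : OK :=
  (x.1 * y.1 + x.2 * y.2 * xi2t d, x.1 * y.2 + x.2 * y.1 + x.2 * y.2 * xi2s d).
(* complex conjugation: conj xi = -xi, resp. 1 - xi *)
Definition OKconj (d : int) (x : OK) : OK :=
  if d1mod4 d then (x.1 + x.2, - x.2) else (x.1, - x.2).

Definition is_ideal (d : int) (P : OK -> Prop) : Prop :=
  [/\ P OK0, (forall x y, P x -> P y -> P (OKadd x y)),
      (forall x, P x -> P (OKopp x)) & (forall r x, P x -> P (OKmul d r x))].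

Definition prime_ideal (d : int) (P : OK -> Prop) : Prop :=
  [/\ is_ideal d P, ~ P OK1 & forall x y, P (OKmul d x y) -> P x \/ P y].

Definition nat_ideal (p : nat) (x : OK) : Prop :=
  exists y : OK, x = (p%:Z * y.1, p%:Z * y.2).

Definition ideal_prod (d : int) (P Q : OK -> Prop) (x : OK) : Prop :=
  exists s : seq (OK * OK), (forall u, u \in s -> P u.1 /\ Q u.2) /\
    x = foldr (fun u acc => OKadd (OKmul d u.1 u.2) acc) OK0 s.

Definition conj_ideal (d : int) (P : OK -> Prop) (x : OK) : Prop := P (OKconj d x).

Definition splits (d : int) (p : nat) : Prop :=
  prime p /\ exists P : OK -> Prop,
    [/\ prime_ideal d P, ~ (forall x, P x <-> conj_ideal d P x)
      & forall x, nat_ideal p x <-> ideal_prod d P (conj_ideal d P) x].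

(* The data (prime ideal fp above p, ring isomorphism M : F_p -> O_K/fp) is
   encoded by phi := M^-1 o (reduction mod fp) : O_K -> F_p, a surjective ring
   morphism whose kernel is fp.  Then (v_i + fp)_i in M(C) iff (phi v_i)_i in C. *)
Definition residue_map (d : int) (p : nat) (phi : OK -> 'F_p) : Prop :=
  [/\ phi OK1 = 1,
      (forall x y, phi (OKadd x y) = phi x + phi y),
      (forall x y, phi (OKmul d x y) = phi x * phi y),
      (forall c : 'F_p, exists x, phi x = c)
    & exists P : OK -> Prop,
      [/\ prime_ideal d P, (forall x, nat_ideal p x -> P x)
        & forall x, phi x = 0 <-> P x]].

Definition codes (p N n : nat) : {set {set 'rV['F_p]_N}} :=
  [set C | [exists G : 'M['F_p]_(n, N),
              (\rank G == n) && (C == [set x | (x <= G)%MS])]].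

Section Real.
Variable R : realType.

(* embedding O_K^N -> C^N = R^(2N): first block real parts, second block imaginary parts *)
Definition reXi (d : int) : R := if d1mod4 d then 2^-1 else 0.
Definition imXi (d : int) : R :=
  if d1mod4 d then Num.sqrt ((- d)%:~R) / 2 else Num.sqrt ((- d)%:~R).

Definition emb (d : int) (N : nat) (a b : 'I_N -> int) : 'rV[R]_(N + N) :=
  row_mx (\row_i ((a i)%:~R + (b i)%:~R * reXi d)) (\row_i ((b i)%:~R * imXi d)).

Definition box_int (K : nat) (z : 'I_(2 * K + 1)) : int := (z : nat)%:Z - K%:Z.

Definition lattice_box_sum (d : int) (N p : nat) (phi : OK -> 'F_p)
    (C : {set 'rV['F_p]_N}) (g : R) (f : 'rV[R]_(N + N) -> R) (K : nat) : R :=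
  \sum_(a : {ffun 'I_N -> 'I_(2 * K + 1)})
   \sum_(b : {ffun 'I_N -> 'I_(2 * K + 1)})
    (if ((\row_i phi (box_int (a i), box_int (b i))) \in C)
        && (g *: emb d (fun i => box_int (a i)) (fun i => box_int (b i)) != 0)
     then f (g *: emb d (fun i => box_int (a i)) (fun i => box_int (b i)))
     else 0).

(* sum_{v in gamma Lambda_C \ {0}} f(v)  (a finite sum when f has bounded support) *)
Definition lattice_sum (d : int) (N p : nat) (phi : OK -> 'F_p)
    (C : {set 'rV['F_p]_N}) (g : R) (f : 'rV[R]_(N + N) -> R) : R :=
  limn (lattice_box_sum d phi C g f).

Definition bounded_support (m : nat) (f : 'rV[R]_m -> R) : Prop :=
  exists M : R, forall x, f x != 0 -> forall i, `|x 0 i| <= M.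

(* Riemann sum over the grid of cubes prod_i [c_i/k, (c_i+1)/k], c_i = z_i - L,
   with tags t z in the cube z *)
Definition riemann_sum (m : nat) (f : 'rV[R]_m -> R) (k L : nat)
    (t : {ffun 'I_m -> 'I_(2 * L)} -> 'rV[R]_m) : R :=
  (k%:R ^- m) * \sum_(z : {ffun 'I_m -> 'I_(2 * L)}) f (t z).

Definition good_tags (m k L : nat) (t : {ffun 'I_m -> 'I_(2 * L)} -> 'rV[R]_m) : Prop :=
  forall (z : {ffun 'I_m -> 'I_(2 * L)}) (i : 'I_m), ((z i : nat)%:R - L%:R) / k%:R <= t z 0 i <= ((z i : nat)%:R - L%:R + 1) / k%:R.

(* f (of bounded support, in [-M,M]^m) is Riemann integrable with integral I:
   tagged Riemann sums over uniform grids of mesh 1/k, covering the support,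
   converge to I as k -> oo, uniformly in the tags. *)
Definition is_riemann_integral (m : nat) (f : 'rV[R]_m -> R) (I : R) : Prop :=
  exists M : R, (forall x, f x != 0 -> forall i, `|x 0 i| <= M) /\
    forall eps : R, 0 < eps -> exists K0 : nat,
      forall k L : nat, (K0 <= k)%N -> (0 < k)%N -> k%:R * M + 1 <= L%:R ->
      forall t, @good_tags m k L t -> `|@riemann_sum m f k L t - I| < eps.

End Real.

(* Main.v *)
Require Import Defs.
From HB Require Import structures.
From mathcomp Require Import all_boot all_order all_algebra.
From mathcomp Require Import all_classical all_reals all_analysis.
From mathcomp Require Import ring lra zify.
Import Order.TTheory GRing.Theory Num.Theory.
Import numFieldNormedType.Exports.
Local Open Scope ring_scope.

(** Every nonzero word lies in the same proportion [(p^n - 1)/(p^N - 1)] of the codes, because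
    [GL_N] permutes the codes and is transitive on nonzero vectors. A nonzero lattice point
    reducing to the zero word has a coordinate whose norm is a positive multiple of [p], so its
    length is at least [gamma sqrt p], which tends to infinity, and [f] does not see it. The
    average is therefore [V^-1] times a Riemann sum of [f] over the lattice [gamma O_K^N], up to
    a factor tending to 1 and the term at the origin. Such sums converge to the integral by
    comparison with a fixed cubical grid, whose cubes contain the right asymptotic number of
    lattice points. *)

(** * Codes through a given nonzero word *)

(** The rank-one matrix [B] takes [x] to [y] and is injective on the line of [x]; a matrix that
    preserves the rank of [x] agrees there with an invertible one. *)
Lemma unitmx_transitive {F : fieldType} {N : nat} (x y : 'rV[F]_N) :
  x != 0 -> y != 0 -> exists2 A : 'M[F]_N, A \in unitmx & x *m A = y.
Proof.
move=> x0 y0.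
have [i xi0] : exists i, x 0 i != 0.
  by apply/rV0Pn.
pose B : 'M[F]_N := (x 0 i)^-1 *: (delta_mx i 0 *m y).
have xB : x *m B = y.
  rewrite /B -scalemxAr mulmxA -colE.
  have -> : col i x = (x 0 i)%:M by apply/matrixP => a b; rewrite !ord1 !mxE eqxx mulr1n.
  by rewrite mul_scalar_mx scalerA mulVf // scale1r.
have [|A Au xA] := @complete_unitmx _ _ _ x B.
  by rewrite xB !rank_rV x0 y0.
by exists A; rewrite // -xA.
Qed.

Lemma card_row_space {F : finFieldType} {n N : nat} (G : 'M[F]_(n, N)) :
  \rank G = n -> #|[set x : 'rV[F]_N | (x <= G)%MS]| = (#|F| ^ n)%N.
Proof.
move=> rG.
have Ginj : injective (fun u : 'rV[F]_n => u *m G).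
  by apply: row_free_inj; rewrite /row_free rG.
have -> : [set x : 'rV[F]_N | (x <= G)%MS] = [set u *m G | u in [set: 'rV[F]_n]].
  apply/setP => x; rewrite inE; apply/submxP/imsetP => [[u ->]|[u _ ->]].
    by exists u.
  by exists u.
by rewrite card_imset // cardsT card_mx mul1n.
Qed.

Lemma codes_gt0 (p N n : nat) : (n <= N)%N -> (0 < #|codes p N n|)%N.
Proof.
move=> nN; apply/card_gt0P.
exists [set x | (x <= (pid_mx n : 'M['F_p]_(n, N)))%MS].
rewrite inE; apply/existsP; exists (pid_mx n); rewrite eqxx andbT.
by rewrite rank_pid_mx.
Qed.

(** An invertible matrix taking [x] to [y] maps the codes through [x] injectively to codes through
    [y]. The roles of [x] and [y] can be swapped, so the two counts agree. *)
Lemma codes_through_le (p N n : nat) (x y : 'rV['F_p]_N) : x != 0 -> y != 0 ->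
  (#|[set C in codes p N n | x \in C]| <= #|[set C in codes p N n | y \in C]|)%N.
Proof.
move=> x0 y0; have [A Au xA] := unitmx_transitive _ _ x0 y0.
pose T (C : {set 'rV['F_p]_N}) := [set u *m A | u in C].
have Ainj : injective (fun u : 'rV['F_p]_N => u *m A).
  by apply: (can_inj (g := fun u => u *m invmx A)) => u; rewrite mulmxK.
rewrite -(card_imset _ (imset_inj Ainj)); apply: subset_leq_card.
apply/fintype.subsetP => _ /imsetP[C + ->]; rewrite !inE => /andP[/existsP[G /andP[/eqP rG /eqP CG]] xC].
apply/andP; split; last by rewrite -xA; apply: imset_f.
apply/existsP; exists (G *m A); rewrite mxrankMfree ?rG ?eqxx ?row_free_unit //=.
apply/eqP/setP => z; rewrite inE; apply/imsetP/idP => [[u]|zG].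
  by rewrite CG inE => uG ->; apply: submxMr.
exists (z *m invmx A); last by rewrite mulmxKV.
by rewrite CG inE -(mulmxK Au G); apply: submxMr.
Qed.

(* Double counting of the pairs (x, C) with x a nonzero word of C. *)
Lemma codes_through_count (p N n : nat) (x : 'rV['F_p]_N) : prime p -> x != 0 ->
  (#|[set C in codes p N n | x \in C]| * (p ^ N - 1) = #|codes p N n| * (p ^ n - 1))%N.
Proof.
move=> pp x0.
have cst y : y != 0 -> #|[set C in codes p N n | y \in C]| = #|[set C in codes p N n | x \in C]|.
  by move=> y0; apply/eqP; rewrite eqn_leq !codes_through_le.
have : (\sum_(C in codes p N n) \sum_(y in C | y != 0%R) 1 =
        \sum_(y : 'rV['F_p]_N | y != 0%R) #|[set C in codes p N n | y \in C]|)%N.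
  rewrite (exchange_big_dep (fun y : 'rV['F_p]_N => y != 0)) /=; last by move=> C y _ /andP[].
  apply: eq_bigr => y y0; rewrite -sum1_card; apply: eq_bigl => C.
  by rewrite !inE y0 andbT.
rewrite (eq_bigr (fun=> (p ^ n - 1)%N)); last first.
  move=> C; rewrite inE => /existsP[G /andP[/eqP rG /eqP CG]].
  have := card_row_space _ rG; rewrite -CG card_Fp // => <-.
  rewrite (cardsD1 0 C) CG inE sub0mx addKn -sum1_card.
  by apply: eq_bigl => y; rewrite !inE andbC.
rewrite sum_nat_const => ->.
rewrite (eq_bigr _ cst) sum_nat_const mulnC; congr (_ * _)%N.
have <- : #|{: 'rV['F_p]_N}| = (p ^ N)%N by rewrite card_mx card_Fp // mul1n.
rewrite -cardsT (cardsD1 0) inE addKn.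
by apply: eq_card => y; rewrite !inE andbT.
Qed.

(** * Norm, complex embedding and reduction on the ring of integers *)

Lemma imXi_gt0 (R : realType) (d : int) : d < 0 -> 0 < imXi R d.
Proof.
move=> d0; have s0 : 0 < Num.sqrt ((- d)%:~R : R) by rewrite sqrtr_gt0 ltr0z oppr_gt0.
by rewrite /imXi; case: ifP => _ //; rewrite divr_gt0.
Qed.

Lemma reXi_itv (R : realType) (d : int) : 0 <= reXi R d <= 2^-1.
Proof. by rewrite /reXi; case: ifP => _; apply/andP; split; lra. Qed.

(** Both sides are the covolume of [O_K] in the complex plane, the area spanned by [1] and [xi]. *)
Lemma imXi_disc (R : realType) (d : int) : d < 0 ->
  Num.sqrt (`|disc d|%:~R) / 2 = imXi R d.
Proof.
move=> d0; rewrite /imXi /disc; case: ifP => _; first by rewrite ltr0_norm.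
rewrite normrM [`|d|]ltr0_norm //; rewrite intrM sqrtrM ?ler0z //.
have -> : `|4|%:~R = 2 ^+ 2 :> R by rewrite -natrX.
by rewrite sqrtr_sqr normr_nat mulrAC mulfV ?mul1r // pnatr_eq0.
Qed.

Definition OKnorm (d : int) (x : OK) : int :=
  x.1 ^+ 2 + x.1 * x.2 * xi2s d - x.2 ^+ 2 * xi2t d.

Lemma OKmul_conj (d : int) (x : OK) : OKmul d x (OKconj d x) = (OKnorm d x, 0).
Proof.
rewrite /OKmul /OKconj /OKnorm /xi2s; case: ifP => _ /=; congr (_, _); ring.
Qed.

Lemma OKnorm_emb (R : realType) (d : int) (x : OK) : d < 0 ->
  (OKnorm d x)%:~R = (x.1%:~R + x.2%:~R * reXi R d) ^+ 2 + (x.2%:~R * imXi R d) ^+ 2.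
Proof.
move=> d0; have s2 : Num.sqrt ((- d)%:~R : R) ^+ 2 = - d%:~R.
  by rewrite sqr_sqrtr ?mulrNz // oppr_ge0 lerz0 ltW.
rewrite /OKnorm /reXi /imXi /xi2s /xi2t; case: ifP => d1; rewrite !rmorphD /= mulrNz !intrM.
  (* The integer division hidden in [xi2t] is exact in this case. *)
  have dE : d%:~R = 4 * ((d - 1) %/ 4)%Z%:~R + 1 :> R.
    have {1}-> : d = 4 * ((d - 1) %/ 4)%Z + 1 by move: d1; rewrite /d1mod4; lia.
    by rewrite rmorphD /= intrM.
  by rewrite [(_ * (_ / 2)) ^+ 2]exprMn [(_ / 2) ^+ 2]exprMn s2 dE; field.
rewrite [(_ * Num.sqrt _) ^+ 2]exprMn s2; ring.
Qed.

Lemma residue_intr (d : int) (p : nat) (phi : OK -> 'F_p) (m : int) :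
  residue_map d phi -> phi (m, 0) = m%:~R.
Proof.
case=> phi1 phiD _ _ _.
have phi0 : phi (0, 0) = 0.
  by apply: (addrI (phi (0, 0))); rewrite -phiD addr0 /OKadd /= addr0.
have phiS k : phi (k + 1, 0) = phi (k, 0) + 1 by rewrite -phi1 -phiD /OKadd /= addr0.
elim/int_ind: m => [|k IH|k IH] //.
  have -> : Posz k.+1 = Posz k + 1 by rewrite -addn1 PoszD.
  by rewrite phiS IH rmorphD.
have -> : - Posz k.+1 = - Posz k - 1 by rewrite -addn1 PoszD opprD.
by apply: (addIr 1); rewrite -phiS subrK IH rmorphB /= subrK.
Qed.

(* The norm of a nonzero element of the prime ideal is a positive multiple of p. *)
Lemma residue_ker_norm (R : realType) (d : int) (p : nat) (phi : OK -> 'F_p) (x : OK) :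
  d < 0 -> prime p -> residue_map d phi -> x != OK0 -> phi x = 0 ->
  p%:R <= (x.1%:~R + x.2%:~R * reXi R d) ^+ 2 + (x.2%:~R * imXi R d) ^+ 2.
Proof.
move=> d0 pp rphi x0 px; have [_ _ phiM _ _] := rphi.
have s0 := imXi_gt0 R d d0.
have n0 : 0 < OKnorm d x.
  rewrite -(ltr0z R) OKnorm_emb //; case: x x0 {px} => a b; rewrite xpair_eqE /=.
  have [->|b0 _] := eqVneq b 0.
    by rewrite andbT !mul0r addr0 expr0n addr0 => a0; rewrite exprn_even_gt0 //= intr_eq0.
  by rewrite ltr_wpDl ?sqr_ge0 // exprn_even_gt0 //= mulf_neq0 ?intr_eq0 // gt_eqF.
(* Since [x * conj x] is the integer [OKnorm d x], applying [phi] shows that this integer vanishes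
   in ['F_p], so [p] divides it. *)
rewrite -OKnorm_emb //; have /(residue_intr _ _ _ (OKnorm d x)) := rphi.
rewrite -OKmul_conj phiM px mul0r; case: (OKnorm d x) n0 => // m m0 /esym/eqP.
by rewrite -[_%:~R]/(m%:R) -(dvdn_pcharf (pchar_Fp pp)) ler_nat => /dvdn_leq; apply.
Qed.

(** * Integer points in intervals and in skew planar cells *)

(** The sum is the ceiling of [y]: the bound [y <= n] ensures that no integer below [y] is
    missed. *)
Lemma sum_ord_lt (R : realType) (n : nat) (y : R) : 0 <= y -> y <= n%:R ->
  y <= \sum_(j < n) (j%:R < y)%R%:R <= y + 1.
Proof.
move=> y0; elim: n => [|n IH] yn.
  by rewrite big_ord0; apply/andP; split; lra.
rewrite big_ord_recr /=; have [yn'|ny] := leP y n%:R.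
  by rewrite addr0; exact: IH.
rewrite (eq_bigr (fun=> 1)).
  by rewrite sumr_const card_ord mulr1n; rewrite -natr1 in yn; apply/andP; split; lra.
by move=> j _; rewrite (lt_trans _ ny) // ltr_nat.
Qed.

(** The count is a difference of two ceilings. Each exceeds its endpoint by an amount between 0 and
    1, so the errors differ by at most 1. *)
Lemma sum_ord_itv (R : realType) (n : nat) (lo hi : R) :
  0 <= lo -> lo <= hi -> hi <= n%:R ->
  `|\sum_(j < n) (lo <= j%:R < hi)%R%:R - (hi - lo)| <= 1.
Proof.
move=> lo0 lohi hin.
have -> : \sum_(j < n) (lo <= j%:R < hi)%R%:R =
    \sum_(j < n) (j%:R < hi)%R%:R - \sum_(j < n) (j%:R < lo)%R%:R :> R.
  rewrite -sumrB; apply: eq_bigr => j _; rewrite leNgt.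
  have [jlo|_] := ltP j%:R lo; last by rewrite subr0.
  by rewrite (lt_le_trans jlo lohi) subrr.
have := sum_ord_lt R n lo lo0 (le_trans lohi hin).
have := sum_ord_lt R n hi (le_trans lo0 lohi) hin.
by move=> /andP[? ?] /andP[? ?]; rewrite ler_norml; apply/andP; split; lra.
Qed.

Lemma box_intE (R : realType) (K : nat) (j : 'I_(2 * K + 1)) :
  (box_int j)%:~R = j%:R - K%:R :> R.
Proof. by rewrite /box_int rmorphB. Qed.

Lemma box_int_le (R : realType) (K : nat) (j : 'I_(2 * K + 1)) :
  `|(box_int j)%:~R| <= K%:R :> R.
Proof.
rewrite box_intE ler_norml; have j2 : (j <= 2 * K)%N by have := ltn_ord j; lia.
by move: j2 (ler0n R j); rewrite -(ler_nat R) natrM => ? ?; apply/andP; split; lra.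
Qed.

Lemma sum_box_itv (R : realType) (K : nat) (lo hi : R) :
  - K%:R <= lo -> lo <= hi -> hi <= K%:R ->
  `|\sum_(j < 2 * K + 1) (lo <= (box_int j)%:~R < hi)%R%:R - (hi - lo)| <= 1.
Proof.
move=> Klo lohi hiK.
rewrite (eq_bigr (fun j : 'I_(2 * K + 1) => (lo + K%:R <= j%:R < hi + K%:R)%R%:R)).
  have -> : hi - lo = (hi + K%:R) - (lo + K%:R) by ring.
  by apply: sum_ord_itv; rewrite ?natrD ?natrM; lra.
by move=> j _; rewrite box_intE lerBrDr ltrBlDr.
Qed.

(** Count of the points of [h O_K] in a square of side [s], weighted by the covolume
    [h ^+ 2 * sigma]. The rows [y] that meet the square are counted first, then the points of each
    row. [E] bounds the position of the square, so that the box of size [K] contains all points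
    concerned. *)
Lemma sum_box_skew (R : realType) (K : nat) (h rho sigma s E u1 u2 : R) :
  0 < h -> 0 < sigma -> 0 <= rho <= 2^-1 -> h <= s -> h * sigma <= s ->
  - E <= u1 -> u1 + s <= E -> - E <= u2 -> u2 + s <= E ->
  2 * E <= h * K%:R -> E <= h * sigma * K%:R ->
  (s - h) * (s - h * sigma) <= h ^+ 2 * sigma *
    (\sum_(x < 2 * K + 1) \sum_(y < 2 * K + 1)
     ((u1 <= h * ((box_int x)%:~R + (box_int y)%:~R * rho) < u1 + s) &&
      (u2 <= h * ((box_int y)%:~R * sigma) < u2 + s))%R%:R) <= (s + h) * (s + h * sigma).
Proof.
move=> h0 s0 /andP[r0 r2] hs hss Eu1 u1E Eu2 u2E EK EsK.
have hs0 : 0 < h * sigma by rewrite mulr_gt0.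
pose c (y : 'I_(2 * K + 1)) : R :=
  (u2 / (h * sigma) <= (box_int y)%:~R < (u2 + s) / (h * sigma))%R%:R.
pose g (y : 'I_(2 * K + 1)) : R := \sum_(x < 2 * K + 1)
  (u1 / h - (box_int y)%:~R * rho <= (box_int x)%:~R < (u1 + s) / h - (box_int y)%:~R * rho)%R%:R.
set S := (X in h ^+ 2 * sigma * X).
(* The second condition involves only [y]; for fixed [y] the first confines [x] to an interval of
   length [s / h], translated by the skew. *)
have -> : S = \sum_y c y * g y.
  rewrite /S exchange_big; apply: eq_bigr => y _; rewrite mulr_sumr; apply: eq_bigr => x _.
  rewrite /c -natrM mulnb andbC; congr (_ && _)%:R.
    by rewrite ler_pdivrMr // ltr_pdivlMr // mulrCA.
  by rewrite lerBlDr ltrBrDr ler_pdivrMr // ltr_pdivlMr // mulrC.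
have g_itv y : s / h - 1 <= g y <= s / h + 1.
  have : `|g y - (((u1 + s) / h - (box_int y)%:~R * rho) - (u1 / h - (box_int y)%:~R * rho))| <= 1.
    (* The skew uses up at most half of the range of [x], as [rho <= 1/2]; [2 * E <= h * K] leaves
       the other half for the interval itself. *)
    have yr : `|(box_int y)%:~R * rho| <= K%:R / 2.
      by rewrite normrM (ger0_norm r0) ler_pM ?normr_ge0 ?box_int_le.
    have u1h : - (K%:R / 2) <= u1 / h by rewrite ler_pdivlMr //; lra.
    have u1h' : (u1 + s) / h <= K%:R / 2 by rewrite ler_pdivrMr //; lra.
    move: yr; rewrite ler_norml => /andP[? ?].
    apply: sum_box_itv; [lra| |lra].
    by rewrite lerD2r ler_pM2r ?invr_gt0 //; lra.
  have -> : (u1 + s) / h - (box_int y)%:~R * rho - (u1 / h - (box_int y)%:~R * rho) = s / h.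
    by rewrite mulrDl; ring.
  by rewrite ler_norml => /andP[? ?]; apply/andP; split; lra.
have c_itv : s / (h * sigma) - 1 <= \sum_y c y <= s / (h * sigma) + 1.
  have : `|\sum_y c y - ((u2 + s) / (h * sigma) - u2 / (h * sigma))| <= 1.
    apply: sum_box_itv.
    - by rewrite ler_pdivlMr //; lra.
    - by rewrite ler_pM2r ?invr_gt0 //; lra.
    - by rewrite ler_pdivrMr //; lra.
  have -> : (u2 + s) / (h * sigma) - u2 / (h * sigma) = s / (h * sigma) by rewrite mulrDl; ring.
  by rewrite ler_norml => /andP[? ?]; apply/andP; split; lra.
have c0 y : 0 <= c y by rewrite ler0n.
have sh : 1 <= s / h by rewrite ler_pdivlMr // mul1r.
have shs : 1 <= s / (h * sigma) by rewrite ler_pdivlMr // mul1r.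
have hsig : 0 <= h ^+ 2 * sigma by rewrite mulr_ge0 ?sqr_ge0 ?ltW.
have hn : h != 0 by rewrite gt_eqF.
have sn : sigma != 0 by rewrite gt_eqF.
move: c_itv => /andP[c1 c2]; apply/andP; split.
  have -> : (s - h) * (s - h * sigma) =
      h ^+ 2 * sigma * ((s / (h * sigma) - 1) * (s / h - 1)) by field; rewrite hn.
  apply: ler_wpM2l => //; apply: (@le_trans _ _ (\sum_y c y * (s / h - 1))).
    by rewrite -mulr_suml ler_wpM2r // subr_ge0.
  by apply: ler_sum => y _; apply: ler_wpM2l => //; case/andP: (g_itv y).
have -> : (s + h) * (s + h * sigma) =
    h ^+ 2 * sigma * ((s / (h * sigma) + 1) * (s / h + 1)) by field; rewrite hn.
apply: ler_wpM2l => //; apply: (@le_trans _ _ (\sum_y c y * (s / h + 1))).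
  by apply: ler_sum => y _; apply: ler_wpM2l => //; case/andP: (g_itv y).
by rewrite -mulr_suml ler_wpM2r //; lra.
Qed.

(** * Cubical grids and Riemann sums *)

(** Half-open, unlike the closed cubes of [good_tags], so that distinct cells are disjoint and each
    point is counted once. *)
Definition in_cell (R : realType) (m k L : nat) (z : {ffun 'I_m -> 'I_(2 * L)})
    (x : 'rV[R]_m) : bool :=
  [forall i, ((z i)%:R - L%:R) / k%:R <= x 0 i < ((z i)%:R - L%:R + 1) / k%:R].
Arguments in_cell {R m} k {L} z x.

Lemma in_cell_exists_unique (R : realType) (m k L : nat) (x : 'rV[R]_m) :
  (0 < k)%N -> (forall i, - L%:R <= k%:R * x 0 i < L%:R) ->
  exists z0 : {ffun 'I_m -> 'I_(2 * L)}, forall z, in_cell k z x = (z == z0).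
Proof.
move=> k0 xL; have k0' : 0 < k%:R :> R by rewrite ltr0n.
have y0 i : 0 <= k%:R * x 0 i + L%:R by case/andP: (xL i); lra.
have y2L i : (Num.truncn (k%:R * x 0 i + L%:R)%R < 2 * L)%N.
  by rewrite truncn_lt_nat // natrM; case/andP: (xL i); lra.
(* The cell index is the integer part of [k * x_i + L], which is nonnegative and below [2 * L] by
   hypothesis. *)
exists [ffun i => Ordinal (y2L i)] => z.
have cellE i : (((z i)%:R - L%:R) / k%:R <= x 0 i < ((z i)%:R - L%:R + 1) / k%:R) =
    (Num.truncn (k%:R * x 0 i + L%:R) == z i).
  rewrite truncn_eq // ler_pdivrMr // ltr_pdivlMr // lerBlDr -natr1 [x 0 i * _]mulrC.
  by congr (_ && _); rewrite -[RHS]ltrBrDr; congr (_ < _); ring.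
apply/forallP/eqP => [zx|zE i].
  by apply/ffunP => i; apply/val_inj; rewrite ffunE /=; move: (zx i); rewrite cellE => /eqP.
by rewrite cellE zE ffunE.
Qed.

Lemma riemann_grid (R : realType) (m : nat) (f : 'rV[R]_m -> R) (I eps : R) :
  is_riemann_integral f I -> 0 < eps -> exists k L : nat,
    [/\ (0 < k)%N, forall x, f x != 0 -> forall i, - L%:R <= k%:R * x 0 i < L%:R &
        forall t, @good_tags R m k L t -> `|riemann_sum f k t - I| < eps].
Proof.
move=> [M [fM fI]] e0; have [K0 HK] := fI _ e0.
(* The margin 1 in [k * M + 1 <= L] makes the upper bound on the support strict, as half-open cells
   require. *)
pose k := K0.+1; pose L := (Num.truncn (k%:R * M + 1)).+1.
have kML : k%:R * M + 1 <= L%:R by rewrite ltW // truncnS_gt.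
exists k, L; split => // [x fx i|t tt]; last by apply: (HK k L).
have := fM x fx i; rewrite ler_norml => /andP[Mx xM].
have k0 : 0 < k%:R :> R by rewrite ltr0n.
rewrite -(ler_pM2l k0) in xM; rewrite -(ler_pM2l k0) mulrN in Mx.
by apply/andP; split; lra.
Qed.

Lemma in_cell_good (R : realType) (m k L : nat) (t : {ffun 'I_m -> 'I_(2 * L)} -> 'rV[R]_m) :
  (forall z, in_cell k z (t z)) -> good_tags k t.
Proof. by move=> tc z i; have /forallP/(_ i)/andP[-> /ltW] := tc z. Qed.

(* Moving a single tag inside its cube changes the Riemann sum by a bounded amount. *)
Lemma riemann_integral_bounded (R : realType) (m : nat) (f : 'rV[R]_m -> R) (I : R) :
  is_riemann_integral f I -> exists B : R, forall x, `|f x| <= B.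
Proof.
move=> fI; have [k [L [k0 fL fI1]]] := riemann_grid R m f I 1 fI ltr01.
have k0' : 0 < k%:R :> R by rewrite ltr0n.
have km0 : 0 < k%:R ^+ m :> R by rewrite exprn_gt0.
pose t0 (z : {ffun 'I_m -> 'I_(2 * L)}) : 'rV[R]_m := \row_i (((z i)%:R - L%:R) / k%:R).
have t0c z : in_cell k z (t0 z).
  by apply/forallP => i; rewrite mxE lexx /= ltr_pM2r ?invr_gt0 // ltrDl.
(* Two Riemann sums within 1 of [I] that differ in one tag force the two values of [f] to differ by
   at most [2 * k ^ m]; the sum bounds the old value, whichever cube contains [x]. *)
exists (2 * k%:R ^+ m + \sum_z `|f (t0 z)|) => x.
have S0 : 0 <= \sum_z `|f (t0 z)| by apply: sumr_ge0.
have [->|fx0] := eqVneq (f x) 0; first by rewrite normr0 addr_ge0 // mulr_ge0 // ltW.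
have [z0 zx] := in_cell_exists_unique R m k L x k0 (fL x fx0).
pose t1 z := if z == z0 then x else t0 z.
have t1c z : in_cell k z (t1 z).
  by rewrite /t1; case: eqP => // ->; rewrite zx eqxx.
have := fI1 _ (in_cell_good _ _ _ _ _ t1c); have := fI1 _ (in_cell_good _ _ _ _ _ t0c).
rewrite /riemann_sum (bigD1 z0) //= [in X in _ -> X -> _](bigD1 z0) //=.
rewrite [in X in _ -> X -> _](eq_bigr (fun z => f (t0 z))); last first.
  by move=> z /negbTE zz0; rewrite /t1 zz0.
rewrite {1}/t1 eqxx !mulrDr; set X := _ * \sum_(i | _) _ => H0 H1.
have fz : `|f (t0 z0)| <= \sum_z `|f (t0 z)|.
  by rewrite (bigD1 z0) //= lerDl sumr_ge0.
have : `|k%:R ^- m * (f x - f (t0 z0))| <= 2.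
  rewrite mulrBr; move: H0 H1; rewrite !ltr_norml => /andP[? ?] /andP[? ?].
  by rewrite ler_norml; apply/andP; split; lra.
rewrite normrM gtr0_norm ?invr_gt0 // mulrC ler_pdivrMr // => H.
have := ler_normB (f x - f (t0 z0)) (- f (t0 z0)); rewrite opprK subrK normrN; lra.
Qed.

(** Each cube is tagged with one of its points [x t] where [f] is largest. If [w] times the number
    of points in a cube is its volume up to [eta], the weighted sum exceeds that Riemann sum by at
    most [eta * B] per cube. Applied to [f] and to [- f], this bounds the sum from both sides. *)
Lemma sum_le_riemann (R : realType) (m : nat) (f : 'rV[R]_m -> R) (I eps : R) (k L : nat)
    (T : finType) (x : T -> 'rV[R]_m) (w eta B : R) :
  (0 < k)%N -> (forall y, f y != 0 -> forall i, - L%:R <= k%:R * y 0 i < L%:R) ->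
  (forall t, @good_tags R m k L t -> riemann_sum f k t <= I + eps) ->
  (forall y, `|f y| <= B) -> 0 <= w -> eta < k%:R ^- m ->
  (forall z : {ffun 'I_m -> 'I_(2 * L)},
    `|w * \sum_t (in_cell k z (x t))%:R - k%:R ^- m| <= eta) ->
  w * \sum_t f (x t) <= I + eps + #|{ffun 'I_m -> 'I_(2 * L)}|%:R * (eta * B).
Proof.
move=> k0 fL fI fB w0 etak cnt.
have fcell t : f (x t) =
    \sum_(z : {ffun 'I_m -> 'I_(2 * L)}) (in_cell k z (x t))%:R * f (x t).
  rewrite -mulr_suml; have [->|fx0] := eqVneq (f (x t)) 0; first by rewrite mulr0.
  have [z0 zx] := in_cell_exists_unique R m k L (x t) k0 (fL _ fx0).
  rewrite (bigD1 z0) //= zx eqxx big1 ?addr0 ?mul1r // => z /negbTE zz0.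
  by rewrite zx zz0.
have tagP (z : {ffun 'I_m -> 'I_(2 * L)}) :
    {y | in_cell k z y /\ forall t, in_cell k z (x t) -> f (x t) <= f y}.
  have [t0 t0z|noT] := pickP (fun t => in_cell k z (x t)).
    case: (@Order.TotalTheory.arg_maxP _ _ T t0 (fun t => in_cell k z (x t)) (fun t => f (x t)) t0z).
    by move=> t tz tmax; exists (x t).
  (* An empty cube would have counting error equal to its full volume, which is more than [eta]. *)
  exfalso; have := cnt z; rewrite big1 => [|t _]; last by rewrite noT.
  rewrite mulr0 sub0r normrN => /(le_lt_trans)/(_ etak).
  by rewrite ltNge ler_norm.
pose tag z := sval (tagP z).
have tagc z : in_cell k z (tag z) by case: (svalP (tagP z)).
have tagmax z t : in_cell k z (x t) -> f (x t) <= f (tag z).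
  by case: (svalP (tagP z)) => _; apply.
apply: (@le_trans _ _ (\sum_(z : {ffun 'I_m -> 'I_(2 * L)}) (k%:R ^- m * f (tag z) + eta * B))).
  rewrite (eq_bigr _ (fun t _ => fcell t)) exchange_big mulr_sumr; apply: ler_sum => z _.
  apply: (@le_trans _ _ (w * (\sum_t (in_cell k z (x t))%:R) * f (tag z))).
    rewrite -mulrA; apply: ler_wpM2l => //; rewrite mulr_suml; apply: ler_sum => t _.
    by case: (boolP (in_cell _ _ _)) => [/tagmax|_]; rewrite ?mul0r ?mul1r.
  rewrite -lerBlDl -mulrBl; apply: le_trans (ler_norm _) _.
  by rewrite normrM ler_pM.
rewrite big_split /= sumr_const -mulr_sumr; apply: lerD; last by rewrite mulr_natl.
exact/fI/in_cell_good.
Qed.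

(** * Lattice points in a cell of the grid *)

Lemma emb_lshift (R : realType) (d : int) (N : nat) (a b : 'I_N -> int) (h : R) (i : 'I_N) :
  (h *: emb R d a b) 0 (lshift N i) = h * ((a i)%:~R + (b i)%:~R * reXi R d).
Proof. by rewrite mxE row_mxEl mxE. Qed.

Lemma emb_rshift (R : realType) (d : int) (N : nat) (a b : 'I_N -> int) (h : R) (i : 'I_N) :
  (h *: emb R d a b) 0 (rshift N i) = h * ((b i)%:~R * imXi R d).
Proof. by rewrite mxE row_mxEr mxE. Qed.

(** The real and imaginary parts of coordinate [i] depend only on [(a i, b i)], so the indicator of
    a cell factors over [i]. *)
Lemma in_cell_emb (R : realType) (d : int) (N k L : nat) (a b : 'I_N -> int) (h : R)
    (z : {ffun 'I_(N + N) -> 'I_(2 * L)}) :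
  let u i : R := ((z i)%:R - L%:R) / k%:R in
  (in_cell k z (h *: emb R d a b))%:R = \prod_i
    ((u (lshift N i) <= h * ((a i)%:~R + (b i)%:~R * reXi R d) < u (lshift N i) + k%:R^-1) &&
     (u (rshift N i) <= h * ((b i)%:~R * imXi R d) < u (rshift N i) + k%:R^-1))%R%:R :> R.
Proof.
move=> u; have uS i : u i + k%:R^-1 = ((z i)%:R - L%:R + 1) / k%:R by rewrite [RHS]mulrDl mul1r.
case: (boolP (in_cell _ _ _)) => [/forallP zc|/forallPn[j]].
  rewrite big1 // => i _; rewrite !uS.
  by move: (zc (lshift N i)) (zc (rshift N i)); rewrite emb_lshift emb_rshift => -> ->.
case: (splitP j) => i ji.
  have -> : j = lshift N i by apply: val_inj.
  by rewrite emb_lshift -uS => /negbTE zi; rewrite (bigD1 i) //= zi mul0r.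
have -> : j = rshift N i by apply: val_inj.
by rewrite emb_rshift -uS => /negbTE zi; rewrite (bigD1 i) //= zi andbF mul0r.
Qed.

(** Since the indicator factors, the double sum over [a] and [b] is a product of [N] planar counts,
    each bounded by [sum_box_skew]. *)
Lemma lattice_cell_count (R : realType) (d : int) (N k L K : nat) (h : R)
    (z : {ffun 'I_(N + N) -> 'I_(2 * L)}) :
  let s : R := k%:R^-1 in let E := L%:R / k%:R in let sigma := imXi R d in
  d < 0 -> (0 < k)%N -> 0 < h -> h <= s -> h * sigma <= s ->
  2 * E <= h * K%:R -> E <= h * sigma * K%:R ->
  ((s - h) * (s - h * sigma)) ^+ N <=
  h ^+ (2 * N) * sigma ^+ N *
    (\sum_(a : {ffun 'I_N -> 'I_(2 * K + 1)}) \sum_(b : {ffun 'I_N -> 'I_(2 * K + 1)})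
      (in_cell k z (h *: emb R d (fun i => box_int (a i)) (fun i => box_int (b i))))%:R)
  <= ((s + h) * (s + h * sigma)) ^+ N.
Proof.
move=> s E sigma d0 k0 h0 hs hss EK EsK.
have k0' : 0 < k%:R :> R by rewrite ltr0n.
have sg0 : 0 < sigma by exact: imXi_gt0.
pose u i : R := ((z i)%:R - L%:R) / k%:R.
pose F i (x y : 'I_(2 * K + 1)) : R :=
  ((u (lshift N i) <= h * ((box_int x)%:~R + (box_int y)%:~R * reXi R d) < u (lshift N i) + s) &&
   (u (rshift N i) <= h * ((box_int y)%:~R * sigma) < u (rshift N i) + s))%R%:R.
rewrite (eq_bigr (fun a : {ffun 'I_N -> 'I_(2 * K + 1)} => \prod_i \sum_y F i (a i) y)); last first.
  move=> a _; rewrite bigA_distr_bigA /=; apply: eq_bigr => b _.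
  exact: in_cell_emb.
rewrite -(bigA_distr_bigA (fun i x => \sum_y F i x y)) exprM -exprMn.
rewrite -[in X in _ <= X * _ <= _](card_ord N) -prodr_const -big_split /=.
have Fi i : (s - h) * (s - h * sigma) <= h ^+ 2 * sigma * (\sum_x \sum_y F i x y) <=
    (s + h) * (s + h * sigma).
  have uE j : - E <= u j.
    by rewrite /E -mulNr ler_pM2r ?invr_gt0 // lerBrDl subrr.
  have uE' j : u j + s <= E.
    rewrite /u /s /E -[X in _ + X]mul1r -mulrDl ler_pM2r ?invr_gt0 //.
    by have := ltn_ord (z j); rewrite -(ler_nat R) natrM -natr1; lra.
  by apply: (sum_box_skew _ _ _ _ _ _ E) => //; exact: reXi_itv.
have shs0 : 0 <= (s - h) * (s - h * sigma) by rewrite mulr_ge0 ?subr_ge0.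
rewrite -[in X in X <= _ <= _](card_ord N) -[in X in _ <= _ <= X](card_ord N) -!prodr_const.
by apply/andP; split; apply: ler_prod => i _; case/andP: (Fi i) => F1 F2; rewrite ?F1 ?F2 ?shs0 ?(le_trans shs0).
Qed.

(** * Truncation of lattice sums, and Riemann sums over the skew grid *)

Lemma sum_box_widen (R : realType) (N K1 K : nat) (G : ('I_N -> int) -> R) :
  (K1 <= K)%N -> (forall a, G a != 0 -> forall i, `|a i| <= K1%:Z) ->
  \sum_(a : {ffun 'I_N -> 'I_(2 * K + 1)}) G (fun i => box_int (a i)) =
  \sum_(a : {ffun 'I_N -> 'I_(2 * K1 + 1)}) G (fun i => box_int (a i)).
Proof.
move=> KK GK.
(* An index [j] of the small box stands for [j - K1]; shifting it by [K - K1] gives the index of the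
   same integer in the large box. *)
have lt_up (j : 'I_(2 * K1 + 1)) : (j + (K - K1) < 2 * K + 1)%N by have := ltn_ord j; lia.
have lt0 : (0 < 2 * K1 + 1)%N by lia.
pose up (a : {ffun 'I_N -> 'I_(2 * K1 + 1)}) : {ffun 'I_N -> 'I_(2 * K + 1)} :=
  [ffun i => Ordinal (lt_up (a i))].
pose dn (a : {ffun 'I_N -> 'I_(2 * K + 1)}) : {ffun 'I_N -> 'I_(2 * K1 + 1)} :=
  [ffun i => insubd (Ordinal lt0) (a i - (K - K1))%N].
rewrite (bigID (fun a : {ffun 'I_N -> 'I_(2 * K + 1)} =>
  [forall i, `|box_int (a i)| <= K1%:Z])) /= addrC big1 ?add0r; last first.
  by move=> a; apply: contraNeq => Ga; apply/forallP; exact: GK.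
rewrite (reindex_onto up dn) /=; last first.
  move=> a /forallP aK; apply/ffunP => i; apply: val_inj; rewrite !ffunE /= val_insubd.
  by have := aK i; rewrite /box_int; have := ltn_ord (a i); case: ifP; lia.
apply: eq_big => [a|a _].
  apply/andP; split.
    by apply/forallP => i; rewrite ffunE /box_int /=; have := ltn_ord (a i); lia.
  apply/eqP/ffunP => i; apply: val_inj; rewrite !ffunE /= val_insubd addnK.
  by rewrite ltn_ord.
congr G; apply/funext => i; rewrite ffunE /box_int /=; lia.
Qed.

(** The box sums are constant from [K] on. On the support, imaginary parts give
    [|b i| <= M / (g * imXi R d)], and real parts give [|a i| <= M / g + |b i|] because [reXi] is at
    most [1/2]. *)
Lemma lattice_sumE (R : realType) (d : int) (N p : nat) (phi : OK -> 'F_p)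
    (C : {set 'rV['F_p]_N}) (g M : R) (f : 'rV[R]_(N + N) -> R) (K : nat) :
  d < 0 -> 0 < g -> (forall x, f x != 0 -> forall i, `|x 0 i| <= M) ->
  M / g + M / (g * imXi R d) <= K%:R ->
  lattice_sum d phi C g f = lattice_box_sum d phi C g f K.
Proof.
move=> d0 g0 fM MK; have s0 := imXi_gt0 R d d0.
have gs0 : 0 < g * imXi R d by rewrite mulr_gt0.
pose G (a b : 'I_N -> int) : R :=
  if ((\row_i phi (a i, b i)) \in C) && (g *: emb R d a b != 0) then f (g *: emb R d a b) else 0.
have GK a b : G a b != 0 -> forall i, `|a i| <= K%:Z /\ `|b i| <= K%:Z.
  rewrite /G; case: ifP => [_ /fM fab i|]; last by rewrite eqxx.
  have := fab (lshift N i); have := fab (rshift N i); rewrite emb_lshift emb_rshift mulrCA.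
  rewrite !normrM (gtr0_norm g0) (gtr0_norm s0) -ler_pdivlMr // [g * `|_|]mulrC -ler_pdivlMr // => bM aM.
  have /andP[r0 r2] := reXi_itv R d.
  have M0 : 0 <= M / g by apply: le_trans aM.
  split; rewrite -(ler_int R) intr_norm; last by apply: le_trans MK; lra.
  apply: le_trans MK.
  have -> : (a i)%:~R = ((a i)%:~R + (b i)%:~R * reXi R d) - (b i)%:~R * reXi R d by ring.
  apply: le_trans (ler_normB _ _) _; apply: lerD => //; apply: le_trans bM.
  by rewrite normrM ler_piMr // ger0_norm //; lra.
rewrite /lattice_sum; apply: norm_lim_near_cst; exists K => // K' /= KK'.
rewrite /lattice_box_sum.
pose H K2 (a : 'I_N -> int) := \sum_(b : {ffun 'I_N -> 'I_(2 * K2 + 1)}) G a (fun i => box_int (b i)).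
have HK a : H K' a = H K a.
  by apply: sum_box_widen => // b Gab i; case: (GK _ _ Gab i).
transitivity (\sum_(a : {ffun 'I_N -> 'I_(2 * K' + 1)}) H K (fun i => box_int (a i))).
  by apply: eq_bigr => a _; rewrite -HK.
apply: sum_box_widen => // a; apply: contraNP => /existsNP[i ai].
apply/eqP/big1 => b _; apply/eqP; apply: contra_notT ai => Gab.
by case: (GK _ _ Gab i).
Qed.

(* Riemann sums over the skew grid [h O_K^N] also converge to the integral: only finitely
   many cubes of a fixed grid matter, each contains asymptotically the right number of lattice
   points, and the lattice points in a cube compete with the best tags of that cube. *)
Lemma lattice_riemann_sum (R : realType) (d : int) (N : nat) (f : 'rV[R]_(N + N) -> R) (I eps : R) :
  d < 0 -> is_riemann_integral f I -> 0 < eps ->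
  exists2 delta : R, 0 < delta & forall h, 0 < h -> h < delta ->
    exists K1 : nat, forall K, (K1 <= K)%N ->
    `|h ^+ (2 * N) * imXi R d ^+ N *
      (\sum_(a : {ffun 'I_N -> 'I_(2 * K + 1)}) \sum_(b : {ffun 'I_N -> 'I_(2 * K + 1)})
        f (h *: emb R d (fun i => box_int (a i)) (fun i => box_int (b i)))) - I| < eps.
Proof.
move=> d0 fI e0; have sg0 := imXi_gt0 R d d0; set sigma := imXi R d in sg0 *.
have [B fB] := riemann_integral_bounded R _ f I fI.
have B0 : 0 <= B by apply: le_trans (fB 0).
have e20 : 0 < eps / 2 by rewrite divr_gt0.
have [k [L [k0 fL fI2]]] := riemann_grid R _ f I _ fI e20.
have k0' : 0 < k%:R :> R by rewrite ltr0n.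
pose s : R := k%:R^-1; have s0 : 0 < s by rewrite invr_gt0.
have kE : k%:R ^- (N + N) = s ^+ (2 * N) by rewrite exprVn mul2n addnn.
pose Z : R := #|{ffun 'I_(N + N) -> 'I_(2 * L)}|%:R.
have ZB0 : 0 <= Z * B by rewrite mulr_ge0 // ler0n.
have ZB1 : 0 < Z * B + 1 by lra.
(* The first bound keeps [eta] below the volume of a cube; the second keeps the error over all [Z]
   cubes at most [eps / 4]. The added 1 avoids dividing by zero. *)
pose eta := Num.min (s ^+ (2 * N) / 2) (eps / 4 / (Z * B + 1)).
have sN0 : 0 < s ^+ (2 * N) by rewrite exprn_gt0.
have eta0 : 0 < eta by rewrite lt_min !divr_gt0.
have eta_s : eta < s ^+ (2 * N).
  by apply: (@le_lt_trans _ _ (s ^+ (2 * N) / 2)); [rewrite ge_min lexx | lra].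
have eta_e : Z * (eta * B) <= eps / 4.
  have : eta * (Z * B + 1) <= eps / 4 by rewrite -ler_pdivlMr // ge_min lexx orbT.
  by have := mulrCA Z eta B; lra.
have /cvgrPdist_lt/(_ eta eta0)/nbhs_ballP[r /= r0 Hr] := @exprn_continuous R (2 * N)%N s.
have sg1 : 0 < 1 + sigma by rewrite addr_gt0.
(* For such [h] the perturbation [h + h * sigma] of the side [s] is below both [s] and the radius
   [r] within which the power [2 * N] moves by less than [eta]. *)
exists (Num.min s r / (1 + sigma)); first by rewrite divr_gt0 // lt_min s0.
move=> h h0; rewrite ltr_pdivlMr // lt_min mulrDr mulr1 => /andP[hs hr].
have hsg0 : 0 < h * sigma by rewrite mulr_gt0.
pose E : R := L%:R / k%:R; have E0 : 0 <= E by rewrite divr_ge0.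
exists (Num.truncn (2 * E / h + E / (h * sigma))).+1 => K K1K.
have KE : 2 * E / h + E / (h * sigma) <= K%:R.
  by rewrite ltW // (lt_le_trans (truncnS_gt _)) // ler_nat.
have Eh0 : 0 <= 2 * E / h by rewrite divr_ge0 ?mulr_ge0 // ltW.
have Ehs0 : 0 <= E / (h * sigma) by rewrite divr_ge0 // ltW.
have EK : 2 * E <= h * K%:R by rewrite [X in _ <= X]mulrC -ler_pdivrMr //; lra.
have EsK : E <= h * sigma * K%:R by rewrite [X in _ <= X]mulrC -ler_pdivrMr //; lra.
pose T : finType := ({ffun 'I_N -> 'I_(2 * K + 1)} * {ffun 'I_N -> 'I_(2 * K + 1)})%type.
pose x (t : T) := h *: emb R d (fun i => box_int (t.1 i)) (fun i => box_int (t.2 i)).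
have cnt (z : {ffun 'I_(N + N) -> 'I_(2 * L)}) :
    `|h ^+ (2 * N) * sigma ^+ N * (\sum_t (in_cell k z (x t))%:R) - k%:R ^- (N + N)| <= eta.
  rewrite -(pair_bigA _ (fun a b => (in_cell k z (x (a, b)))%:R)) /=.
  have := lattice_cell_count R d N k L K h z d0 k0 h0.
  move=> /(_ ltac:(rewrite -/s; lra) ltac:(rewrite -/s -/sigma; lra) EK EsK).
  rewrite -/s -/sigma /x /=; set c := _ * (\sum_a _) => /andP[c1 c2]; rewrite kE.
  have near_s y : `|y - s| < r -> `|y ^+ (2 * N) - s ^+ (2 * N)| < eta.
    move=> ys; rewrite distrC; apply: Hr.
    by rewrite /ball /= distrC.
  have c1' : (s - (h + h * sigma)) ^+ (2 * N) <= c.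
    apply: le_trans c1; rewrite exprM lerXn2r ?nnegrE ?sqr_ge0 ?mulr_ge0 //; try lra.
    by rewrite expr2 ler_pM //; lra.
  have c2' : c <= (s + (h + h * sigma)) ^+ (2 * N).
    apply: le_trans c2 _; rewrite exprM lerXn2r ?nnegrE ?sqr_ge0 ?mulr_ge0 //; try lra.
    by rewrite expr2 ler_pM //; lra.
  have := near_s (s - (h + h * sigma)); have := near_s (s + (h + h * sigma)).
  rewrite [s + _ - s]addrAC subrr add0r [s - _ - s]addrAC subrr add0r normrN gtr0_norm ?addr_gt0 //.
  move=> /(_ hr) + /(_ hr); rewrite !ltr_norml => /andP[? ?] /andP[? ?].
  by rewrite ler_norml; apply/andP; split; lra.
have w0 : 0 <= h ^+ (2 * N) * sigma ^+ N by rewrite mulr_ge0 // exprn_ge0 // ltW.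
have etak : eta < k%:R ^- (N + N) by rewrite kE.
rewrite (pair_bigA _ (fun a b => f (x (a, b)))) /=.
have -> : \sum_(t : T) f (x (t.1, t.2)) = \sum_t f (x t) by [].
have up : h ^+ (2 * N) * sigma ^+ N * (\sum_t f (x t)) <= I + eps / 2 + Z * (eta * B).
  apply: sum_le_riemann etak cnt => // t /fI2.
  by rewrite ltr_norml => /andP[_]; lra.
have lo : h ^+ (2 * N) * sigma ^+ N * (\sum_t - f (x t)) <= - I + eps / 2 + Z * (eta * B).
  apply: (sum_le_riemann R _ (fun y => - f y)) etak cnt => //.
  - by move=> y; rewrite oppr_eq0; exact: fL.
  - move=> t /fI2; rewrite ltr_norml => /andP[+ _].
    by rewrite /riemann_sum sumrN mulrN; lra.
  - by move=> y; rewrite normrN.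
rewrite sumrN mulrN in lo.
by rewrite ltr_norml; apply/andP; split; lra.
Qed.

(** * Averaging the truncated sum over all codes *)

Lemma emb_eq0 (R : realType) (d : int) (N : nat) (a b : 'I_N -> int) (h : R) : d < 0 -> h != 0 ->
  h *: emb R d a b = 0 <-> forall i, (a i, b i) = OK0.
Proof.
move=> d0 h0; have s0 : imXi R d != 0 by rewrite gt_eqF ?imXi_gt0.
split=> [v0 i|ab0].
  have := emb_rshift R d N a b h i; rewrite v0 mxE => /esym/eqP.
  rewrite !mulf_eq0 (negbTE h0) (negbTE s0) orbF /= intr_eq0 => /eqP bi.
  have := emb_lshift R d N a b h i; rewrite v0 mxE bi mul0r addr0 => /esym/eqP.
  by rewrite mulf_eq0 (negbTE h0) /= intr_eq0 => /eqP ->.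
apply/rowP => j; rewrite [RHS]mxE.
case: (splitP j) => i ji; case: (ab0 i) => ai bi.
  have -> : j = lshift N i by apply: val_inj.
  by rewrite emb_lshift ai bi mul0r addr0 mulr0.
have -> : j = rshift N i by apply: val_inj.
by rewrite emb_rshift bi mul0r mulr0.
Qed.

(** After exchanging the sums, each nonzero vector in the support of [f] is weighted by the number
    of codes through its reduction, which is the same for every nonzero word. Excluding the origin
    accounts for [- f 0]. *)
Lemma sum_codes_lattice_box (R : realType) (d : int) (N n p : nat) (phi : OK -> 'F_p)
    (g M : R) (f : 'rV[R]_(N + N) -> R) (K : nat) :
  d < 0 -> (0 < N)%N -> prime p -> residue_map d phi -> 0 < g ->
  (forall x, f x != 0 -> forall i, `|x 0 i| <= M) -> 2 * M ^+ 2 < g ^+ 2 * p%:R ->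
  \sum_(C in codes p N n) lattice_box_sum d phi C g f K =
  #|codes p N n|%:R * ((p%:R ^+ n - 1) / (p%:R ^+ N - 1)) *
  (\sum_(a : {ffun 'I_N -> 'I_(2 * K + 1)}) \sum_(b : {ffun 'I_N -> 'I_(2 * K + 1)})
     f (g *: emb R d (fun i => box_int (a i)) (fun i => box_int (b i))) - f 0).
Proof.
move=> d0 N0 pp rphi g0 fM Mg; have gn0 : g != 0 by rewrite gt_eqF.
set c := _ * (_ / _).
pose v (a b : {ffun 'I_N -> 'I_(2 * K + 1)}) : 'rV[R]_(N + N) :=
  g *: emb R d (fun i => box_int (a i)) (fun i => box_int (b i)).
have p1 : 1 < p%:R :> R by rewrite ltr1n prime_gt1.
have pN : p%:R ^+ N - 1 != 0 :> R by rewrite subr_eq0 gt_eqF // exprn_egt1 // -lt0n.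
have ptN j : (p ^ j - 1)%N%:R = p%:R ^+ j - 1 :> R by rewrite natrB ?natrX // expn_gt0 prime_gt0.
have term (a b : {ffun 'I_N -> 'I_(2 * K + 1)}) : \sum_(C in codes p N n)
    (if ((\row_i phi (box_int (a i), box_int (b i))) \in C) && (v a b != 0) then f (v a b) else 0) =
    c * (if v a b == 0 then 0 else f (v a b)) :> R.
  have [v0|v0] := eqVneq (v a b) 0; first by rewrite mulr0 big1 // => C _; rewrite andbF.
  have [f0|f0] := eqVneq (f (v a b)) 0; first by rewrite f0 mulr0 big1 // => C _; rewrite if_same.
  (* If the word were zero, some nonzero coordinate would have squared modulus at least
     [g ^+ 2 * p], whereas its real and imaginary parts are each at most [M]. *)
  set y := \row_i _; have y0 : y != 0.
    apply/eqP => y0; move/eqP: v0; apply; apply/emb_eq0 => // i.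
    apply/eqP; apply: contraLR Mg => ab0; rewrite -leNgt.
    have px : phi (box_int (a i), box_int (b i)) = 0 by move/rowP/(_ i): y0; rewrite !mxE.
    have := residue_ker_norm R d p phi _ d0 pp rphi ab0 px; rewrite /= => pn.
    apply: (@le_trans _ _ (`|v a b 0 (lshift N i)| ^+ 2 + `|v a b 0 (rshift N i)| ^+ 2)).
      rewrite !real_normK ?num_real // emb_lshift emb_rshift [X in _ <= X + _]exprMn.
      by rewrite [X in _ <= _ + X]exprMn -mulrDr ler_wpM2l // sqr_ge0.
    have M0 : 0 <= M by apply: le_trans (fM _ f0 (lshift N i)).
    by rewrite mulr2n mulrDl !mul1r lerD // lerXn2r ?nnegrE ?normr_ge0 //; exact: fM.
  rewrite -big_mkcondr /= (eq_bigl (fun C => C \in [set C in codes p N n | y \in C])); last first.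
    by move=> C; rewrite inE andbT.
  rewrite sumr_const -mulr_natl; congr (_ * _).
  by rewrite /c mulrA; apply: (canRL (mulfK pN)); rewrite -!ptN -!natrM codes_through_count.
rewrite /lattice_box_sum exchange_big /=.
under eq_bigr => a _ do (rewrite exchange_big /=; under eq_bigr => b _ do rewrite term).
under eq_bigr => a _ do rewrite -mulr_sumr.
rewrite -mulr_sumr; congr (_ * _).
have K1 : (K < 2 * K + 1)%N by lia.
(* Index [K] stands for the integer 0. *)
pose a0 : {ffun 'I_N -> 'I_(2 * K + 1)} := [ffun=> Ordinal K1].
have vE a b : (v a b == 0) = ((a, b) == (a0, a0)).
  apply/eqP/eqP => [/emb_eq0 ab0|[-> ->]]; last first.
    by apply/emb_eq0 => // i; rewrite ffunE /box_int /= subrr.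
  have {}ab0 i := ab0 d0 gn0 i.
  congr (_, _); apply/ffunP => i; apply: val_inj; rewrite ffunE /=;
    by case: (ab0 i); rewrite /box_int; lia.
rewrite !pair_bigA /= (bigD1 (a0, a0)) //= [in RHS](bigD1 (a0, a0)) //=.
rewrite -/(v a0 a0) !vE eqxx add0r.
have -> : v a0 a0 = 0 by apply/eqP; rewrite vE.
rewrite addrAC subrr add0r; apply: eq_bigr => -[a b] /= /negbTE ab.
by rewrite vE ab.
Qed.

(** * Choice of the threshold for [p] and the final error estimate *)

Theorem theorem4 (R : realType) (d : int) (N n : nat) (V : R)
    (f : 'rV[R]_(N + N) -> R) (I : R)
    (phi : forall p : nat, OK -> 'F_p) (gamma : nat -> R) :
  d < 0 -> squarefree d -> (0 < n)%N -> (n < N)%N -> 0 < V ->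
  bounded_support f -> is_riemann_integral f I ->
  (forall p, splits d p -> residue_map d (phi p)) ->
  (forall p, splits d p ->
     0 < gamma p /\
     gamma p ^+ (2 * N) * (Num.sqrt (`|disc d|%:~R) / 2) ^+ N * p%:R ^+ (N - n) = V) ->
  forall eps : R, 0 < eps -> exists P0 : nat, forall p : nat, splits d p -> (P0 < p)%N ->
    `| (#|codes p N n|%:R)^-1 *
         \sum_(C in codes p N n) lattice_sum d (phi p) C (gamma p) f
       - V^-1 * I | < eps.
Proof.
move=> d0 _ n0 nN V0 [M fM] fI phiP gammaP eps e0; have N0 : (0 < N)%N by apply: leq_trans nN.
have sg0 := imXi_gt0 R d d0; set sigma := imXi R d in sg0.
have Ve0 : 0 < V * eps by rewrite mulr_gt0.
have e30 : 0 < V * eps / 3 by rewrite divr_gt0.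
have [delta de0 Hdelta] := lattice_riemann_sum R d N f I _ d0 fI e30.
pose Q := `|I| + V * eps / 3 + 2 * (V * `|f 0|).
have Q0 : 0 < Q by rewrite /Q ltr_pwDl ?ltr_wpDl ?mulr_ge0 // ltW.
(* For [p] above these constants, [c1] forces [g < delta], [c2] forces [2 * M ^+ 2 < g ^+ 2 * p],
   and [c3] forces [Q / p < V * eps / 3]. *)
pose c1 := V / (delta ^+ (2 * N) * sigma ^+ N).
pose c2 := (2 * M ^+ 2) ^+ N * sigma ^+ N / V.
pose c3 := Q / (V * eps / 3).
have sN0 : 0 < sigma ^+ N by rewrite exprn_gt0.
have M20 : 0 <= 2 * M ^+ 2 by rewrite mulr_ge0 // sqr_ge0.
have ds0 : 0 < delta ^+ (2 * N) * sigma ^+ N by rewrite mulr_gt0 // exprn_gt0.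
have c10 : 0 <= c1 by rewrite divr_ge0 // ltW.
have c20 : 0 <= c2 by rewrite divr_ge0 ?mulr_ge0 ?exprn_ge0 // ltW.
have c30 : 0 <= c3 by rewrite divr_ge0 // ltW.
exists (Num.truncn (c1 + c2 + c3)).+1 => p psplit P0p.
have pc : c1 + c2 + c3 < p%:R.
  by rewrite (lt_trans (truncnS_gt _)) // ltr_nat.
have pp : prime p by case: psplit.
have p1 : 1 < p%:R :> R by rewrite ltr1n prime_gt1.
have p0 : 0 < p%:R :> R by apply: lt_trans p1.
have [g0] := gammaP p psplit; rewrite imXi_disc // -/sigma.
set g := gamma p in g0 * => gV.
have pNn : p%:R <= p%:R ^+ (N - n) :> R by rewrite ler_eXnr ?subn_gt0 // ltW.
have pn : p%:R <= p%:R ^+ n :> R by rewrite ler_eXnr // ltW.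
have pNn0 : 0 < p%:R ^+ (N - n) :> R by rewrite exprn_gt0.
have pNE : p%:R ^+ N = p%:R ^+ (N - n) * p%:R ^+ n :> R by rewrite -exprD subnK // ltnW.
have gdelta : g < delta.
  rewrite ltNge; apply/negP => dg.
  have : delta ^+ (2 * N) * sigma ^+ N * p%:R <= V.
    rewrite -gV; apply: ler_pM; rewrite ?(ltW ds0) ?(ltW p0) //.
    by rewrite ler_wpM2r ?(ltW sN0) // lerXn2r // nnegrE ltW.
  rewrite mulrC -ler_pdivlMr // -/c1; lra.
have gM : 2 * M ^+ 2 < g ^+ 2 * p%:R.
  rewrite ltNge; apply/negP => gM.
  have H : (g ^+ 2 * p%:R) ^+ N <= (2 * M ^+ 2) ^+ N.
    by rewrite lerXn2r // nnegrE // mulr_ge0 ?sqr_ge0 // ltW.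
  (* The normalization gives [(g ^+ 2 * p) ^+ N * sigma ^+ N = V * p ^+ n], and [n > 0] makes this
     at least [V * p]. *)
  have : V * p%:R <= (2 * M ^+ 2) ^+ N * sigma ^+ N.
    apply: (@le_trans _ _ ((g ^+ 2 * p%:R) ^+ N * sigma ^+ N)); last by rewrite ler_wpM2r // ltW.
    have -> : (g ^+ 2 * p%:R) ^+ N * sigma ^+ N = V * p%:R ^+ n.
      by rewrite exprMn -exprM -gV pNE; ring.
    by rewrite ler_wpM2l // ltW.
  rewrite mulrC -ler_pdivlMr // -/c2; lra.
have [K1 HK1] := Hdelta g g0 gdelta.
pose K := maxn K1 (Num.truncn (M / g + M / (g * sigma))).+1.
have MK : M / g + M / (g * sigma) <= K%:R.
  by rewrite ltW // (lt_le_trans (truncnS_gt _)) // ler_nat leq_maxr.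
have {HK1} := HK1 K (leq_maxl _ _).
rewrite (eq_bigr (fun C => lattice_box_sum d (phi p) C g f K)); last first.
  by move=> C _; apply: (lattice_sumE _ _ _ _ _ _ _ M).
rewrite (sum_codes_lattice_box _ _ _ _ _ _ _ M) //; last exact: phiP.
rewrite -/sigma; set S := \sum_a \sum_b _; set T := _ * S => TI.
have cn0 : #|codes p N n|%:R != 0 :> R.
  by rewrite pnatr_eq0 -lt0n codes_gt0 // ltnW.
have pN1 : 0 < p%:R ^+ N - 1 :> R by rewrite subr_gt0 exprn_egt1 // -lt0n.
pose q : R := (p%:R ^+ (N - n) - 1) / (p%:R ^+ N - 1).
have ST : S = T * p%:R ^+ (N - n) / V.
  by rewrite /T -gV; field; rewrite !expf_neq0 ?gt_eqF.
(* [q] measures how far the density of codes through a point is from [p^(n-N)], and [w] is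
   the contribution of the excluded origin. *)
pose w := V * f 0 / p%:R ^+ (N - n).
(* The density of codes through a point times [p ^+ (N - n)] is [1 - q], and [S - f 0] is
   [(T - w) * p ^+ (N - n) / V]; hence the average is [V^-1 * (1 - q) * (T - w)]. *)
have -> : (#|codes p N n|%:R)^-1 * (#|codes p N n|%:R *
    ((p%:R ^+ n - 1) / (p%:R ^+ N - 1)) * (S - f 0)) - V^-1 * I =
    V^-1 * ((T - I) - w - q * (T - w)).
  rewrite ST /w /q; move: pN1 pNn0; rewrite pNE.
  move: (p%:R ^+ (N - n)) (p%:R ^+ n) => A B AB A0; field.
  by rewrite cn0 !gt_eqF.
have q0 : 0 <= q by rewrite divr_ge0 ?(ltW pN1) // subr_ge0 (le_trans (ltW p1)).
have qp : q * p%:R <= 1.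
  rewrite /q mulrAC ler_pdivrMr // mul1r pNE mulrBl mul1r.
  by apply: lerB; [rewrite ler_wpM2l // ltW | exact: ltW].
have q1 : q <= 1.
  by apply: le_trans qp; rewrite ler_peMr // ltW.
have wp : `|w| * p%:R <= V * `|f 0|.
  rewrite /w !normrM normfV (gtr0_norm V0) (gtr0_norm pNn0) mulrAC ler_pdivrMr //.
  by rewrite ler_wpM2l // mulr_ge0 // ltW.
have TB : `|T| <= `|I| + V * eps / 3.
  by have := ler_normD (T - I) I; rewrite subrK; lra.
have Qp : Q / p%:R < V * eps / 3.
  by rewrite ltr_pdivrMr // mulrC -ltr_pdivrMr // -/c3; lra.
rewrite normrM gtr0_norm ?invr_gt0 // mulrC ltr_pdivrMr // [eps * V]mulrC.
(* After multiplication by [p], the terms in [w] contribute at most [V * |f 0|] each and the term in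
   [T] at most [|I| + V * eps / 3]; their total is [Q]. *)
have err : `|w| + q * `|T - w| <= Q / p%:R.
  rewrite ler_pdivlMr // mulrDl mulrAC.
  have : q * p%:R * `|T - w| <= q * p%:R * `|T| + q * p%:R * `|w|.
    by rewrite -mulrDr ler_wpM2l ?ler_normB // mulr_ge0 // ltW.
  have : q * p%:R * `|T| <= `|T| by rewrite ler_piMl.
  have : q * p%:R * `|w| <= `|w| * p%:R by rewrite [X in _ <= X]mulrC -mulrA ler_piMl // mulr_ge0 // ltW.
  rewrite /Q; lra.
have := ler_normB (T - I - w) (q * (T - w)); have := ler_normB (T - I) w.
rewrite [`|q * _|]normrM (ger0_norm q0); lra.
Qed.
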